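(* Let $\theta=(k_r)$ be a lacunary sequence with $\liminf_r q_r>1$, let $A\subset\mathbb{R}$ and $f:A\to\mathbb{R}$. If $f$ is $N_\theta$-ward continuous on $A$, then $f$ is $N_\theta$-continuous on $A$.
   Context: A lacunary sequence is an increasing sequence of integers $\theta=(k_r)_{r\ge 0}$ with $k_0=0$ and $h_r:=k_r-k_{r-1}\to\infty$. Put $I_r=(k_{r-1},k_r]$ (integers in this interval) and $q_r=k_r/k_{r-1}$ (for $r\ge 2$). A real sequence $(\alpha_k)_{k\ge1}$ is $N_\theta$-convergent to $\ell\in\mathbb{R}$ if $\lim_{r\to\infty}\frac1{h_r}\sum_{k\in I_r}|\alpha_k-\ell|=0$, and $N_\theta$-quasi-Cauchy if $\lim_{r\to\infty}\frac1{h_r}\sum_{k\in I_r}|\alpha_{k+1}-\alpha_k|=0$. A function $f:A\to\mathbb{R}$ is $N_\theta$-ward continuous on $A$ if $(f(\alpha_k))$ is $N_\theta$-quasi-Cauchy whenever $(\alpha_k)$ is an $N_\theta$-quasi-Cauchy sequence of points in $A$. It is $N_\theta$-continuous on $A$ if, for every $u\in A$ and every sequence $(\alpha_k)$ of points in $A$ that is $N_\theta$-convergent to $u$, the sequence $(f(\alpha_k))$ is $N_\theta$-convergent to $f(u)$. *)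

(* Defs.v *)
From mathcomp Require Import all_boot all_order all_algebra.
From mathcomp Require Import all_classical all_reals all_analysis.
Import Order.TTheory GRing.Theory Num.Theory.
Import numFieldNormedType.Exports.

Set Implicit Arguments.
Unset Strict Implicit.
Unset Printing Implicit Defensive.

Local Open Scope classical_set_scope.
Local Open Scope ring_scope.

(* The quantities attached to the block I_r = (k_(r-1), k_r] are meant for
   r >= 1 (for r >= 2 in the case of the ratio); their values at smaller r are
   junk, and only limits as r tends to infinity are ever taken. *)

Definition block_length (k : nat -> nat) (r : nat) : nat := (k r - k r.-1)%N.

Definition block_ratio (R : realType) (k : nat -> nat) (r : nat) : R :=
  (k r)%:R / (k r.-1)%:R.

(* An increasing sequence of integers starting at 0 takes its values in nat. *)
Definition lacunary (k : nat -> nat) : Prop :=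
  [/\ k 0%N = 0%N,
      {homo k : m n / (m < n)%N} &
      block_length k r @[r --> \oo] --> \oo].

Definition block_mean (R : realType) (k : nat -> nat) (x : nat -> R)
    (r : nat) : R :=
  (block_length k r)%:R^-1 * \sum_((k r.-1).+1 <= i < (k r).+1) x i.

(* Real sequences are indexed from 1: the value at index 0 is never used. *)

Definition Ntheta_cvg (R : realType) (k : nat -> nat) (a : nat -> R) (l : R) :
    Prop :=
  block_mean k (fun i => `|a i - l|) r @[r --> \oo] --> (0 : R).

Definition Ntheta_quasi_cauchy (R : realType) (k : nat -> nat) (a : nat -> R) :
    Prop :=
  block_mean k (fun i => `|a i.+1 - a i|) r @[r --> \oo] --> (0 : R).

Definition points_in (R : realType) (A : set R) (a : nat -> R) : Prop :=
  forall i : nat, (1 <= i)%N -> A (a i).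

(* A function A -> R is represented by a total function of which only the
   values on A matter. *)

Definition Ntheta_ward_continuous (R : realType) (k : nat -> nat) (A : set R)
    (f : R -> R) : Prop :=
  forall a : nat -> R, points_in A a ->
    Ntheta_quasi_cauchy k a -> Ntheta_quasi_cauchy k (fun i => f (a i)).

Definition Ntheta_continuous (R : realType) (k : nat -> nat) (A : set R)
    (f : R -> R) : Prop :=
  forall u : R, A u -> forall a : nat -> R, points_in A a ->
    Ntheta_cvg k a u -> Ntheta_cvg k (fun i => f (a i)) (f u).

(* Main.v *)
Require Import Defs.
From mathcomp Require Import all_boot all_order all_algebra.
From mathcomp Require Import all_classical all_reals all_analysis.
From mathcomp Require Import zify.
Import Order.TTheory GRing.Theory Num.Theory.
Import numFieldNormedType.Exports.

Local Open Scope classical_set_scope.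
Local Open Scope ring_scope.

(** The idea is to interleave [a] with the constant [u], block by block. Let [c]
    be a sequence N_theta-convergent to [u] which equals [u] at the first index
    of every block and at one of any two consecutive indices. As no jump of [c]
    at the end of a block involves the next block, [c] is N_theta-quasi-Cauchy,
    hence so is [f c]; and [|f (c i) - f u|] is bounded by
    [|f (c i.+1) - f (c i)|], so [f c] is N_theta-convergent to [f u]. Three such
    sequences carry all the terms of [a]: its even terms, its odd terms (the
    first terms of blocks being replaced by [u] in both), and the first terms of
    the blocks, each moved one index to the right. *)

Lemma block_mean_ge0 (R : realType) (k : nat -> nat) (x : nat -> R) (r : nat) :
  (forall i, 0 <= x i) -> 0 <= block_mean k x r.
Proof. by move=> x0; rewrite mulr_ge0 ?invr_ge0 ?sumr_ge0. Qed.

Lemma ler_block_mean (R : realType) (k : nat -> nat) (x y : nat -> R) (r : nat) :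
  (forall i, (k r.-1 < i <= k r)%N -> x i <= y i) ->
  block_mean k x r <= block_mean k y r.
Proof.
move=> xy; rewrite ler_wpM2l ?invr_ge0//.
by apply: ler_sum_nat => i; rewrite ltnS; exact: xy.
Qed.

Lemma block_meanD (R : realType) (k : nat -> nat) (x y : nat -> R) (r : nat) :
  block_mean k (x \+ y) r = block_mean k x r + block_mean k y r.
Proof. by rewrite /block_mean big_split mulrDr. Qed.

(** The difference of the two sums telescopes to its boundary terms, which are the values of [x] at
    the first indices of block [r] and of the next block. *)
Lemma block_mean_shift (R : realType) (k : nat -> nat) (x : nat -> R) (r : nat) :
  (k r.-1 <= k r)%N -> x (k r.-1).+1 = 0 -> x (k r).+1 = 0 ->
  block_mean k (fun i => x i.+1) r = block_mean k x r.
Proof.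
move=> kr x0 x1; rewrite /block_mean; congr (_ * _).
by apply/eqP; rewrite -subr_eq0 -sumrB telescope_sumr// x0 x1 subrr.
Qed.

Lemma block_mean_cvg0_le (R : realType) (k : nat -> nat) (x : nat -> R)
    (y : nat -> R) :
  (forall i, 0 <= x i) ->
  (\forall r \near \oo, block_mean k x r <= y r) ->
  y r @[r --> \oo] --> (0 : R) ->
  block_mean k x r @[r --> \oo] --> (0 : R).
Proof.
move=> x0 xy; apply: squeeze_cvgr; last exact: cvg_cst.
by apply: filterS xy => r ->; rewrite block_mean_ge0.
Qed.

Definition block_start (k : nat -> nat) (i : nat) : Prop :=
  exists r, i = (k r).+1.

Lemma lacunary_mono (k : nat -> nat) :
  lacunary k -> {mono k : m n / (m <= n)%N}.
Proof. by case=> _ kh _; exact: leq_mono kh. Qed.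

Lemma ward_continuous_interleaved_cvg (R : realType) (k : nat -> nat)
    (A : set R) (f : R -> R) (u : R) (c : nat -> R) :
  lacunary k -> Ntheta_ward_continuous k A f -> points_in A c ->
  (forall i, block_start k i -> c i = u) ->
  (forall i, c i = u \/ c i.+1 = u) ->
  Ntheta_cvg k c u -> Ntheta_cvg k (fun i => f (c i)) (f u).
Proof.
move=> hk hf cA cstart cc cu.
have cqc : Ntheta_quasi_cauchy k c.
  apply: (@block_mean_cvg0_le _ _ _
    (fun r => block_mean k (fun i => `|c i - u|) r +
              block_mean k (fun i => `|c i - u|) r)) => //; last first.
    by rewrite -[0]addr0; exact: (cvgD cu cu).
  near=> r.
  (* One of the two equal means is shifted, so that the triangle inequality through [u] applies term
     by term. *)
  rewrite -{1}(@block_mean_shift _ k (fun i => `|c i - u|) r).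
  - rewrite -block_meanD; apply: ler_block_mean => i _ /=.
    by rewrite (le_trans _ (ler_normB _ _))// opprB addrA subrK.
  - by rewrite (lacunary_mono _ hk) leq_pred.
  - by rewrite cstart ?subrr ?normr0//; exists r.-1.
  - by rewrite cstart ?subrr ?normr0//; exists r.
apply: (block_mean_cvg0_le _ _ _ _ _ _ (hf c cA cqc)) => //.
near=> r; apply: ler_block_mean => i _.
(* If [c i = u] the left side vanishes; if [c i.+1 = u] both sides agree. *)
by case: (cc i) => ->; rewrite ?subrr ?normr0// distrC.
Unshelve. all: by end_near.
Qed.

Lemma Ntheta_cvg_dominated (R : realType) (k : nat -> nat) (a c : nat -> R)
    (u : R) :
  (forall i, `|c i - u| <= `|a i - u|) -> Ntheta_cvg k a u -> Ntheta_cvg k c u.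
Proof.
move=> ca; apply: block_mean_cvg0_le => //.
by near=> r; apply: ler_block_mean => i _.
Unshelve. all: by end_near.
Qed.

(** If [i] and [i.+1] both start blocks, then [i] is the first and the last index of its block,
    which has length 1; this is excluded for large [r]. *)
Lemma lacunary_start_isolated (k : nat -> nat) : lacunary k ->
  \forall r \near \oo, forall i, (k r.-1 < i <= k r)%N ->
    block_start k i -> ~ block_start k i.+1.
Proof.
move=> hk; have km := lacunary_mono _ hk; have [_ _ /cvgnyPgt h] := hk.
near=> r => i /andP[ri ir] [s es] [t [et]].
have : (1 < block_length k r)%N by near: r; exact: h.
have kmt : {mono k : m n / (m < n)%N} := leqW_mono km.
have st : (s < t)%N by rewrite -kmt -et es.
have rt : (r.-1 < t)%N by rewrite -kmt -et.
have tr : (t <= r)%N by rewrite -km -et.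
have er : r = t by lia.
have : (k s <= k r.-1)%N by rewrite km; lia.
by rewrite /block_length er -et; lia.
Unshelve. all: by end_near.
Qed.

Theorem theorem14 (R : realType) (k : nat -> nat) (A : set R) (f : R -> R)
    (hk : lacunary k)
    (hq : (1%:E < limn_einf (fun r : nat => (block_ratio R k r)%:E))%E)
    (hf : Ntheta_ward_continuous k A f) :
  Ntheta_continuous k A f.
Proof.
move=> u Au a aA au.
(* [c true] keeps the odd terms of [a] and [c false] the even ones, block starts excepted. *)
pose c (b : bool) i :=
  if (odd i == b) && ~~ `[< block_start k i >] then a i else u.
(* The second test keeps [d] equal to [u] at block starts even when a block has length 1. *)
pose d i := if `[< block_start k i.-1 >] && ~~ `[< block_start k i >]
  then a i.-1 else u.
have hc b : Ntheta_cvg k (fun i => f (c b i)) (f u).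
  apply: (ward_continuous_interleaved_cvg _ _ _ _ _ _ hk hf).
  - by move=> i i1; rewrite /c; case: ifP => // _; exact: aA.
  - by move=> i /asboolT si; rewrite /c si andbF.
  - move=> i; rewrite /c /=.
    by case: (odd i) b => -[] /=; auto.
  - apply: Ntheta_cvg_dominated au => i; rewrite /c.
    by case: ifP => // _; rewrite subrr normr0.
have dstart i : block_start k i -> d i = u.
  by move=> /asboolT si; rewrite /d si andbF.
have hd : Ntheta_cvg k (fun i => f (d i)) (f u).
  apply: (ward_continuous_interleaved_cvg _ _ _ _ _ _ hk hf) => //.
  - move=> i i1; rewrite /d; case: ifP => // /andP[/asboolP[s es] _].
    by apply: aA; rewrite es.
  - by move=> i; rewrite /d /=; case: `[< block_start k i >]; rewrite ?andbF; auto.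
  - apply: block_mean_cvg0_le au => //; near=> r.
    (* After the shift, [d i.+1] is either [a i] or [u]. *)
    rewrite -(@block_mean_shift _ k (fun i => `|d i - u|)).
    + apply: ler_block_mean => i _; rewrite /d.
      by case: ifP => // _; rewrite subrr normr0.
    + by rewrite (lacunary_mono _ hk) leq_pred.
    + by rewrite dstart ?subrr ?normr0//; exists r.-1.
    + by rewrite dstart ?subrr ?normr0//; exists r.
apply: (@block_mean_cvg0_le _ _ _ (fun r =>
  block_mean k (fun i => `|f (c true i) - f u|) r +
  block_mean k (fun i => `|f (c false i) - f u|) r +
  block_mean k (fun i => `|f (d i) - f u|) r)) => //; last first.
  by rewrite -[0]addr0 -[X in X + _]addr0; exact: (cvgD (cvgD (hc true) (hc false)) hd).
have hs := lacunary_start_isolated _ hk.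
near=> r.
rewrite -[X in _ + X](@block_mean_shift _ k (fun i => `|f (d i) - f u|)).
- rewrite -!block_meanD; apply: ler_block_mean => i ir /=.
  (* At a block start, [d i.+1 = a i] for large [r]; elsewhere the [c] of the parity of [i] takes
     the value [a i]. The other terms of the bound are nonnegative. *)
  have [si|si] := pselect (block_start k i).
    have sj : ~ block_start k i.+1 by move: i ir si; near: r.
    by rewrite /d /= (asboolT si) (asboolF sj) /= lerDr addr_ge0.
  rewrite /c (asboolF si) /=.
  by case: (odd i) => /=; rewrite ?subrr ?normr0 ?add0r ?lerDl// -addrA lerDl addr_ge0.
- by rewrite (lacunary_mono _ hk) leq_pred.
- by rewrite dstart ?subrr ?normr0//; exists r.-1.
- by rewrite dstart ?subrr ?normr0//; exists r.
Unshelve. all: by end_near.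
Qed.
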